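(* Let $X=\{X_t\}_{t\geq0}$ be a standard one-dimensional Brownian motion starting at $0$ on a probability space $(\Omega,\mathcal{F},\mathbb{P})$. Let $p$ be an atomic proposition interpreted by $B_p=[1,\infty)$, i.e. $X(\omega),t\models p$ iff $X_t(\omega)\geq1$ (and likewise for the discrete semantics). Define $\phi_1:=\Box_{(1,2)}(\Diamond_{(1,4)}p\wedge\lnot\Diamond_{(1,3)}p)$, $\phi_2:=(\Diamond_{(1,3)}\phi_1)\wedge(\lnot\Diamond_{(1,2)}\phi_1)\wedge(\lnot\Diamond_{(2,3)}\phi_1)$, $\phi_3:=\Diamond_{(1,2)}\phi_2$, $\psi:=(\lnot p)\wedge(\lnot\Diamond_{(0,8)}p)\wedge\phi_3$. Then $\mathbb{P}(\omega : X(\omega),0\models_n\psi)$ does not converge to $\mathbb{P}(\omega : X(\omega),0\models\psi)$ as $n\to\infty$.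
   Context: Continuous semantics for $t\geq0$: $X(\omega),t\models p$ iff $X_t(\omega)\in B_p$; negation and conjunction are interpreted classically; $X(\omega),t\models\Diamond_I\phi$ iff there exists $s\in I$ with $X(\omega),t+s\models\phi$; $\Box_I\phi:=\lnot\Diamond_I\lnot\phi$, so $X(\omega),t\models\Box_I\phi$ iff $X(\omega),t+s\models\phi$ for all $s\in I$. Discrete semantics: for $n\in\mathbb{N}$ let $\mathbb{N}/n=\{k/n:k\in\mathbb{N}\}$; for $t\in\mathbb{N}/n$, $X(\omega),t\models_n p$ iff $X_t(\omega)\in B_p$; negation and conjunction classical; $X(\omega),t\models_n\Diamond_I\phi$ iff there exists $s\in I\cap\mathbb{N}/n$ with $X(\omega),t+s\models_n\phi$; $X(\omega),t\models_n\Box_I\phi$ iff $X(\omega),t+s\models_n\phi$ for all $s\in I\cap\mathbb{N}/n$. *)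

(* Defs.v *)
From HB Require Import structures.
From mathcomp Require Import all_boot all_order all_algebra.
From mathcomp Require Import all_classical all_reals all_analysis.
Set Implicit Arguments. Unset Strict Implicit. Unset Printing Implicit Defensive.
Import Order.TTheory GRing.Theory Num.Theory.
Import numFieldNormedType.Exports.
Local Open Scope classical_set_scope.
Local Open Scope ring_scope.

(* Atomic propositions are identified with their interpretation set B_p. *)
Inductive form (R : realType) : Type :=
| FAtom of set R
| FNeg of form R
| FAnd of form R & form R
| FDia of interval R & form R.
Arguments FAtom {R}.
Arguments FNeg {R}.
Arguments FAnd {R}.
Arguments FDia {R}.

Definition FBox {R : realType} (I : interval R) (f : form R) : form R :=
  FNeg (FDia I (FNeg f)).

Fixpoint sat {R : realType} (x : R -> R) (f : form R) (t : R) : Prop :=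
  match f with
  | FAtom B => B (x t)
  | FNeg g => ~ sat x g t
  | FAnd g h => sat x g t /\ sat x h t
  | FDia J g => exists s : R, s \in J /\ sat x g (t + s)
  end.

Definition grid {R : realType} (n : nat) : set R :=
  [set s | exists k : nat, s = k%:R / n%:R].

Fixpoint satn {R : realType} (n : nat) (x : R -> R) (f : form R) (t : R) : Prop :=
  match f with
  | FAtom B => B (x t)
  | FNeg g => ~ satn n x g t
  | FAnd g h => satn n x g t /\ satn n x h t
  | FDia J g => exists s : R, s \in J /\ grid n s /\ satn n x g (t + s)
  end.

Section BM.
Context {d : measure_display} {T : measurableType d} {R : realType}.
Variable P : probability T R.

Definition increment (X : R -> T -> R) (ts : seq R) (i : nat) : T -> R :=
  fun w => X (nth 0 ts i.+1) w - X (nth 0 ts i) w.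

Definition indep_increments (X : R -> T -> R) : Prop :=
  forall ts : seq R, 0 <= head 0 ts -> sorted <%R ts ->
  forall B : nat -> set R, (forall i, measurable (B i)) ->
  P (\bigcap_(i in `I_(size ts).-1) (increment X ts i @^-1` B i)) =
  (\prod_(i < (size ts).-1) P (increment X ts i @^-1` B i))%E.

Definition standard_BM (X : R -> T -> R) : Prop :=
  [/\ (forall t, 0 <= t -> measurable_fun setT (X t)),
      (forall w, X 0 w = 0),
      (forall w, {within `[0, +oo[, continuous (fun t => X t w)}),
      (forall s t, 0 <= s -> s < t -> forall A : set R, measurable A ->
         P ((fun w => X t w - X s w) @^-1` A) = normal_prob 0 (Num.sqrt (t - s)) A)
    & indep_increments X].
End BM.

Definition Iopen {R : realType} (a b : R) : interval R := `]a, b[.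

Definition p_atom {R : realType} : form R := FAtom [set x : R | 1 <= x].

Definition phi1 {R : realType} : form R :=
  FBox (Iopen 1 2) (FAnd (FDia (Iopen 1 4) p_atom) (FNeg (FDia (Iopen 1 3) p_atom))).

Definition phi2 {R : realType} : form R :=
  FAnd (FDia (Iopen 1 3) phi1)
       (FAnd (FNeg (FDia (Iopen 1 2) phi1)) (FNeg (FDia (Iopen 2 3) phi1))).

Definition phi3 {R : realType} : form R := FDia (Iopen 1 2) phi2.

Definition psi {R : realType} : form R :=
  FAnd (FNeg p_atom) (FAnd (FNeg (FDia (Iopen 0 8) p_atom)) phi3).

(* Main.v *)
Require Import Defs.
From HB Require Import structures.
From mathcomp Require Import all_boot all_order all_algebra.
From mathcomp Require Import all_classical all_reals all_analysis.
From mathcomp Require Import measurable_realfun zify ring lra.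
Set Implicit Arguments. Unset Strict Implicit. Unset Printing Implicit Defensive.
Import Order.TTheory GRing.Theory Num.Theory.
Import numFieldNormedType.Exports.
Local Open Scope classical_set_scope.
Local Open Scope ring_scope.

(** Call a time a hit if the path is at least 1 there.  In continuous time phi1
    holds at v iff v + 5 is a hit preceded by no hit on (v + 2, v + 5), so phi2
    holds at w iff w + 7 is a hit preceded by none on (w + 4, w + 7), and psi
    says that the first hit lies in (8, 9).  On the grid of mesh 1/n a single hit
    makes phi1 true at two neighbouring points, which phi2 forbids, so psi is
    unsatisfiable for n >= 2.

    It remains to see that the first hit lies in (8, 9) with positive
    probability.  Cut [0, 8] into N blocks of length h = 8/N and ask the increment
    over each block to lie in [-1, 0] and the increment over [8, 17/2] to lie in
    [N + 1, N + 2]; this has probability q^N r.  Inside a block, the path stays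
    within 1/2 of its initial value as soon as all dyadic increments of level m
    are at most c_m = (1/16) (7/8)^m.  The event that one of them is larger, while
    the requirement on the other blocks still holds, is again an event on
    independent increments, so a union bound and Gaussian tails bound the failure
    probability by q^(N-1) r O(1/N), which is less than q^N r for large N since q
    is bounded below. *)

(** * Discrete semantics *)

(** With integer endpoints, membership of [k/n] in the interval is a strict inequality between
    natural numbers, so the later grid arguments reduce to arithmetic on indices. *)
Lemma satn_FDiaE {R : realType} (n : nat) (x : R -> R) (f : Defs.form R)
    (a b j : nat) : (0 < n)%N ->
  satn n x (FDia (Iopen a%:R b%:R) f) (j%:R / n%:R) <->
  exists k : nat, (a * n < k < b * n)%N /\ satn n x f ((j + k)%:R / n%:R).
Proof.
move=> n0; have n0' : (0 : R) < n%:R by rewrite ltr0n.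
have mem k : ((k%:R / n%:R : R) \in Iopen a%:R b%:R) = (a * n < k < b * n)%N.
  by rewrite in_itv/= ltr_pdivlMr// ltr_pdivrMr// -!natrM !ltr_nat.
split=> [[s [sI [[k sk] /= h]]]|[k [kI h]]].
  by subst s; exists k; rewrite -mem; split => //; rewrite natrD mulrDl.
exists (k%:R / n%:R); split; first by rewrite mem.
by split; [exists k|rewrite -mulrDl -natrD].
Qed.

(** For [n < u < 2n] the inner windows [(u + n, u + 3n)] jointly cover the indices from [2n + 2] to
    [5n - 2]. The outer window of [u = n + 1] ends at [5n], so the required hit has only [5n - 1]
    and [5n] left; either of them serves every [u]. *)
Lemma satn_phi1E {R : realType} (n : nat) (x : R -> R) (j : nat) : (1 < n)%N ->
  let p k := 1 <= x (k%:R / n%:R) in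
  satn n x phi1 (j%:R / n%:R) <->
  (forall k, (2 * n + 2 <= k <= 5 * n - 2)%N -> ~ p (j + k)%N) /\
  (p (j + (5 * n - 1))%N \/ p (j + 5 * n)%N).
Proof.
move=> n1 p; have n0 : (0 < n)%N by lia.
have D f a b i := @satn_FDiaE R n x f a b i n0.
pose far i := satn n x (FDia (Iopen 1 4) p_atom) (i%:R / n%:R).
pose near i := satn n x (FDia (Iopen 1 3) p_atom) (i%:R / n%:R).
have farE i : far i <-> exists k, (1 * n < k < 4 * n)%N /\ p (i + k)%N.
  exact: (D p_atom 1%N 4%N).
have nearE i : near i <-> exists k, (1 * n < k < 3 * n)%N /\ p (i + k)%N.
  exact: (D p_atom 1%N 3%N).
have -> : satn n x phi1 (j%:R / n%:R) <->
    forall u, (1 * n < u < 2 * n)%N -> far (j + u)%N /\ ~ near (j + u)%N.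
  pose g : Defs.form R :=
    FNeg (FAnd (FDia (Iopen 1 4) p_atom) (FNeg (FDia (Iopen 1 3) p_atom))).
  split=> [H u uI|H].
    by apply: contrapT => K; apply: H; apply/(D g 1%N 2%N); exists u; split.
  by move/(D g 1%N 2%N) => [u [uI]]; apply; exact: H.
split=> [H|[H1 H2] u uI]; last first.
  split.
    apply/farE; case: H2 => H2.
      by exists (5 * n - 1 - u)%N; split; [lia|move: H2; congr p; lia].
    by exists (5 * n - u)%N; split; [lia|move: H2; congr p; lia].
  move=> /nearE[r [rI pr]]; apply: (H1 (u + r)%N); first lia.
  by rewrite addnA.
have H1 k : (2 * n + 2 <= k <= 5 * n - 2)%N -> ~ p (j + k)%N.
  (* The two extreme offsets [n + 1] and [2n - 1] already cover all forbidden indices. *)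
  move=> kI pk; have [k4|k4] := leqP k (4 * n).
    have [|_ +] := H (n + 1)%N; first lia.
    by apply; apply/nearE; exists (k - n - 1)%N; split; [lia|move: pk; congr p; lia].
  have [|_ +] := H (2 * n - 1)%N; first lia.
  apply; apply/nearE; exists (k - (2 * n - 1))%N; split; first lia.
  by move: pk; congr p; lia.
split=> //.
have [|/farE[r [rI pr]] nr] := H (n + 1)%N; first lia.
have r3 : (3 * n <= r)%N.
  rewrite leqNgt; apply/negP => r3; apply: nr; apply/nearE; exists r; split => //.
  lia.
have [e|e] := eqVneq (n + 1 + r)%N (5 * n)%N.
  by right; move: pr; congr p; lia.
have [e'|e'] := eqVneq (n + 1 + r)%N (5 * n - 1)%N.
  by left; move: pr; congr p; lia.
exfalso; apply: (H1 (n + 1 + r)%N); first lia.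
by move: pr; congr p; lia.
Qed.

(** The witness of [phi1] inside [phi2] must have offset exactly [2n]. If the hit is at
    [w + 7n - 1], then [phi1] also holds at offset [2n - 1]; if it is at [w + 7n] only, then [phi1]
    also holds at [2n + 1]. Both offsets are excluded by [phi2]. *)
Lemma satn_psi_false {R : realType} (n : nat) (x : R -> R) : (1 < n)%N ->
  ~ satn n x psi 0.
Proof.
move=> n1; have n0 : (0 < n)%N by lia.
have D f a b i := @satn_FDiaE R n x f a b i n0.
have -> : (0 : R) = 0%:R / n%:R by rewrite mul0r.
move=> [_ [np h3]].
have [w [wI]] := (D phi2 1%N 2%N 0%N).1 h3; rewrite add0n => -[d13 [n12 n23]].
have {}np k : (0 < k < 8 * n)%N -> ~ 1 <= x (k%:R / n%:R).
  by move=> kI pk; apply: np; apply/(D p_atom 0%N 8%N); exists k; rewrite add0n.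
have [v [vI hv]] := (D phi1 1%N 3%N w).1 d13.
have [v1 v2] := (satn_phi1E _ _ n1).1 hv.
have {}n12 k : (n < k < 2 * n)%N -> ~ satn n x phi1 ((w + k)%:R / n%:R).
  by move=> kI pk; apply: n12; apply/(D phi1 1%N 2%N); exists k; rewrite mul1n.
have {}n23 k : (2 * n < k < 3 * n)%N -> ~ satn n x phi1 ((w + k)%:R / n%:R).
  by move=> kI pk; apply: n23; apply/(D phi1 2%N 3%N); exists k.
have ev : v = (2 * n)%N.
  apply: contrapT => /eqP; rewrite neq_ltn => /orP[] v2n.
    by apply: (n12 v); [lia|exact: hv].
  by apply: (n23 v); [lia|exact: hv].
subst v; clear hv.
have [p1|np1] := pselect (1 <= x ((w + (7 * n - 1))%N%:R / n%:R)).
  apply: (n12 (2 * n - 1)%N); first lia.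
  apply/(satn_phi1E _ _ n1); split; last first.
    by right; move: p1; congr (_ <= x (_%:R / _)); lia.
  move=> k kI pk; have [k8|k8] := leqP (w + (2 * n - 1) + k)%N (8 * n - 1).
    by apply: np pk; lia.
  apply: (v1 (k - 1)%N); first lia.
  by move: pk; congr (_ <= x (_%:R / _)); lia.
case: v2 => p2.
  by apply: np1; move: p2; congr (_ <= x (_%:R / _)); lia.
apply: (n23 (2 * n + 1)%N); first lia.
apply/(satn_phi1E _ _ n1); split; last first.
  by left; move: p2; congr (_ <= x (_%:R / _)); lia.
move=> k kI pk; have [e|e] := eqVneq k (5 * n - 2)%N.
  by apply: np1; move: pk; congr (_ <= x (_%:R / _)); lia.
apply: (v1 (k + 1)%N); first lia.
by move: pk; congr (_ <= x (_%:R / _)); lia.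
Qed.

(** * Continuous semantics *)

Section path.
Context {R : realType}.
Variable x : R -> R.
Hypothesis x_cont : {within `[0, +oo[, continuous x}.

Lemma path_epsilon_delta (t e : R) : 0 <= t -> 0 < e ->
  exists2 r, 0 < r & forall s, 0 <= s -> `|s - t| < r -> `|x s - x t| < e.
Proof.
move=> t0 e0; have /subspace_continuousP/(_ t) := x_cont.
rewrite /= in_itv/= t0 => /(_ isT)/cvgr_dist_lt/(_ e e0).
rewrite /within/= => -[r /= r0 h]; exists r => // s s0 sr.
rewrite distrC; apply: (h s); last by rewrite /= in_itv/= s0.
by rewrite /= distrC.
Qed.

Lemma path_closed_le (t c : R) : 0 <= t ->
  (forall e, 0 < e -> exists2 s, `|s - t| < e & 0 <= s /\ x s <= c) -> x t <= c.
Proof.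
move=> t0 h; rewrite leNgt; apply/negP => ct.
have /(path_epsilon_delta t0)[r r0 hr] : 0 < x t - c by rewrite subr_gt0.
have [s sr [s0 sc]] := h r r0.
have := hr s s0 sr; rewrite ltr_norml => /andP[]; lra.
Qed.

Lemma path_closed_ge (t c : R) : 0 <= t ->
  (forall e, 0 < e -> exists2 s, `|s - t| < e & 0 <= s /\ c <= x s) -> c <= x t.
Proof.
move=> t0 h; rewrite leNgt; apply/negP => ct.
have /(path_epsilon_delta t0)[r r0 hr] : 0 < c - x t by rewrite subr_gt0.
have [s sr [s0 sc]] := h r r0.
have := hr s s0 sr; rewrite ltr_norml => /andP[]; lra.
Qed.

(** The infimum of the hitting times from [a] on is itself a hitting time by continuity, and it
    differs from [a] because [x a < c]. *)
Lemma path_first_hit (a b c : R) : 0 <= a -> x a < c ->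
  (exists2 t, a < t < b & c <= x t) ->
  exists2 t, a < t < b & c <= x t /\ forall s, a < s < t -> x s < c.
Proof.
move=> a0 xa [t1 /andP[at1 t1b] ct1].
pose S := [set t | a <= t /\ c <= x t]; pose t := inf S.
have St1 : S t1 by split => //; exact: ltW.
have lbS : lbound S a by move=> s [].
have infS : has_inf S by split; [exists t1|exists a].
have at_ : a <= t by apply: lb_le_inf => //; exists t1.
have tS s : S s -> t <= s by move=> Ss; apply: ge_inf => //; exists a.
have ct : c <= x t.
  apply: path_closed_ge; first exact: le_trans at_.
  move=> e e0; have [s Ss se] := inf_adherent e0 infS.
  have := tS s Ss; exists s; first by rewrite ger0_norm; rewrite -/t in se; lra.
  by case: Ss => as_ cs; split => //; lra.
exists t; last first.
  split=> // s /andP[as_ st]; rewrite ltNge; apply/negP => cs.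
  have : t <= s by apply: tS; split => //; exact: ltW.
  lra.
have : a != t by apply/eqP => e; move: xa; rewrite e ltNge ct.
have := tS _ St1; move: at_; rewrite le_eqVlt => /orP[->//|->] /=; lra.
Qed.

(** The windows [(u + 1, u + 3)] for [u] in [(1, 2)] sweep out [(2, 5)]. As [u] decreases to 1, the
    hit required before [u + 4] is squeezed onto 5, where closedness of the target makes it a
    genuine hit. *)
Lemma sat_phi1E (v : R) : 0 <= v ->
  sat x phi1 v <-> 1 <= x (v + 5) /\ forall s, v + 2 < s < v + 5 -> x s < 1.
Proof.
move=> v0; split=> [H|[x5 x25]]; last first.
  move=> [u []]; rewrite in_itv/= => /andP[u1 u2]; apply; split.
    exists (5 - u); split; first by rewrite in_itv/=; apply/andP; split; lra.
    by have -> : v + u + (5 - u) = v + 5 by ring.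
  move=> [r []]; rewrite in_itv/= => /andP[r1 r2]; apply/negP; rewrite -ltNge.
  by apply: x25; apply/andP; split; lra.
have {}H u : 1 < u < 2 ->
    (exists2 r, 1 < r < 4 & 1 <= x (v + u + r)) /\
    (forall r, 1 < r < 3 -> x (v + u + r) < 1).
  move=> uI; apply: contrapT => K; apply: H; exists u; split=> //=.
  move=> [[r [rI xr]] nr]; apply: K; split; first by exists r.
  move=> r' rI'; rewrite ltNge; apply/negP => xr'.
  by apply: nr; exists r'.
have x25 s : v + 2 < s < v + 5 -> x s < 1.
  (* With [d = (s - v - 2) / 3] in [(0, 1)], split [s - v] as [(1 + d) + (1 + 2d)], the summands
     lying in [(1, 2)] and [(1, 3)]. *)
  move=> /andP[s2 s5]; have [|_] := H (1 + (s - v - 2) / 3).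
    by apply/andP; split; lra.
  move=> /(_ (1 + (s - v - 2) / 3 *+ 2)).
  have -> : v + (1 + (s - v - 2) / 3) + (1 + (s - v - 2) / 3 *+ 2) = s by field.
  by apply; apply/andP; split; lra.
split=> //; apply: path_closed_ge; first by lra.
move=> e e0; pose e' := Num.min e 1 / 2.
have e'0 : 0 < e' by rewrite /e' divr_gt0// lt_min e0 ltr01.
have [e'e e'1] : e' < e /\ e' < 1.
  by rewrite /e'; split; case: (lerP e 1) => //; lra.
(* This offset produces a hit in [[v + 5, v + 5 + e')]. *)
have [|[r /andP[r1 r4] xr] nr] := H (1 + e'); first by apply/andP; split; lra.
have r3 : 3 <= r.
  rewrite leNgt; apply/negP => r3; move: xr; rewrite leNgt nr//.
  by rewrite r1.
have s5 : v + 5 <= v + (1 + e') + r.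
  rewrite leNgt; apply/negP => s5; move: xr; rewrite leNgt x25//.
  by rewrite s5 andbT; lra.
exists (v + (1 + e') + r); last by split=> //; lra.
by rewrite ger0_norm; lra.
Qed.

(** The exclusions leave only the offset 2. Conversely, [phi1] at an offset below 2 would put a hit
    in [(w + 6, w + 7)], and at an offset above 2 it would forbid the hit at [w + 7]. *)
Lemma sat_phi2E (w : R) : 0 <= w ->
  sat x phi2 w <-> 1 <= x (w + 7) /\ forall s, w + 4 < s < w + 7 -> x s < 1.
Proof.
move=> w0; split.
  move=> [[v []]]; rewrite in_itv/= => /andP[v1 v3] hv [n12 n23].
  have -> : w + 7 = w + 2 + 5 by ring.
  have -> : w + 4 = w + 2 + 2 by ring.
  apply/sat_phi1E; first lra.
  have [v2|v2|<-//] := ltrgtP v 2.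
    by exfalso; apply: n12; exists v; split=> //; rewrite in_itv/= v1.
  by exfalso; apply: n23; exists v; split=> //; rewrite in_itv/= v3 andbT.
move=> [x7 x47]; split.
  exists 2; split; first by rewrite in_itv/=; apply/andP; split; lra.
  apply/sat_phi1E; first lra.
  have -> : w + 2 + 5 = w + 7 by ring.
  by have -> : w + 2 + 2 = w + 4 by ring.
split=> -[v []]; rewrite in_itv/= => /andP[v1 v2].
  move=> /sat_phi1E[|]; first lra.
  by rewrite leNgt x47//; apply/andP; split; lra.
move=> /sat_phi1E[|_ h]; first lra.
by move: x7; rewrite leNgt h//; apply/andP; split; lra.
Qed.

Lemma sat_psiE : sat x psi 0 <->
  (forall t, 0 <= t <= 8 -> x t < 1) /\ (exists2 t, 8 < t < 9 & 1 <= x t).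
Proof.
split.
  move=> [x0 [x08 [w []]]]; rewrite in_itv/= add0r => /andP[w1 w2].
  move=> /sat_phi2E[|x7 x47]; first lra.
  split; last by exists (w + 7) => //; apply/andP; split; lra.
  move=> t /andP[t0 t8]; rewrite ltNge; apply/negP => xt.
  have [t0'|t0'] := eqVneq t 0; first by apply: x0; rewrite -t0'.
  have [t8'|t8'] := eqVneq t 8.
    by move: xt; rewrite leNgt x47// t8'; apply/andP; split; lra.
  apply: x08; exists t; rewrite add0r in_itv/=; split=> //.
  by rewrite !lt_neqAle t0 t8 t8' eq_sym t0'.
move=> [x08 h].
have x8 : x 8 < 1 by apply: x08; apply/andP; split; lra.
have [|t /andP[t8 t9] [xt x8t]] := @path_first_hit 8 9 1 _ x8 h => //.
split; first by apply/negP; rewrite -ltNge; apply: x08; apply/andP; split; lra.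
split.
  move=> [s []]; rewrite in_itv/= add0r => /andP[s0 s8]; apply/negP.
  by rewrite -ltNge; apply: x08; apply/andP; split; lra.
exists (t - 7); rewrite in_itv/= add0r; split; first by apply/andP; split; lra.
apply/sat_phi2E; first lra.
rewrite subrK; split=> // s /andP[s4 st].
have [s8|s8] := lerP s 8; first by apply: x08; apply/andP; split; lra.
by apply: x8t; apply/andP; split.
Qed.

Lemma path_le_dense_rat (a b c : R) : 0 <= a -> a < b ->
  (forall q : rat, a <= ratr q <= b -> x (ratr q) <= c) ->
  forall t, a <= t <= b -> x t <= c.
Proof.
move=> a0 ab h t /andP[at_ tb]; apply: path_closed_le; first lra.
move=> e e0.
have /rat_in_itvoo[q] : Num.max a (t - e) < Num.min b (t + e).
  by rewrite lt_min !gt_max; do !(apply/andP; split); lra.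
rewrite in_itv/= gt_max lt_min => /andP[/andP[aq tq] /andP[qb qt]].
exists (ratr q); first by rewrite ltr_norml; apply/andP; split; lra.
by split; [lra|apply: h; rewrite !ltW].
Qed.

(** The maximum over the compact interval is attained, so a strict bound leaves a uniform gap. The
    right-hand side involves countably many times only, as measurability requires. *)
Lemma path_lt_gap (a b c : R) : 0 <= a -> a < b ->
  (forall t, a <= t <= b -> x t < c) <->
  exists k, forall q : rat, a <= ratr q <= b -> x (ratr q) <= c - k.+1%:R^-1.
Proof.
move=> a0 ab; split; last first.
  move=> [k h] t tI; rewrite (le_lt_trans (path_le_dense_rat a0 ab h tI))//.
  by rewrite ltrBlDr ltrDl invr_gt0.
move=> h.
have [|m mI hm] := @EVT_max R x a b (ltW ab).
  apply: continuous_subspaceW x_cont => t /=; rewrite !in_itv/= andbT.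
  by move=> /andP[+ _]; exact: le_trans.
have /h xm : a <= m <= b by move: mI; rewrite in_itv.
pose k := Num.truncn (c - x m)^-1.
exists k => q qI.
have : x (ratr q) <= x m by apply: hm; rewrite in_itv.
have : k.+1%:R^-1 < c - x m.
  rewrite invf_plt ?posrE ?subr_gt0//.
  exact: truncnS_gt.
by set e := _^-1; lra.
Qed.

End path.

(** * Measurability of the event that [psi] holds *)

Section measurability.
Context {d : measure_display} {T : measurableType d} {R : realType}.
Variables (X : R -> T -> R).
Hypothesis mX : forall t, 0 <= t -> measurable_fun setT (X t).
Hypothesis X_cont : forall w, {within `[0, +oo[, continuous (fun t => X t w)}.

Lemma measurable_path_lt (a b c : R) : 0 <= a -> a < b ->
  measurable [set w | forall t, a <= t <= b -> X t w < c].
Proof.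
move=> a0 ab.
have -> : [set w | forall t, a <= t <= b -> X t w < c] =
    \bigcup_k ~` \bigcup_(q : rat) [set w | a <= ratr q <= b /\
                                  c - k.+1%:R^-1 < X (ratr q) w].
  apply/seteqP; split=> w /=.
    move=> /(path_lt_gap (@X_cont w) _ a0 ab)[k h]; exists k => // -[q _ [qI]].
    by rewrite ltNge h.
  move=> [k _ h]; apply/(path_lt_gap (@X_cont w) _ a0 ab); exists k => q qI.
  by rewrite leNgt; apply/negP => xq; apply: h; exists q.
apply: bigcupT_measurable => k; apply: measurableC.
apply: bigcupT_measurable_rat => q.
have [qI|qI] := boolP (a <= ratr q <= b); last first.
  rewrite (_ : [set _ | _] = set0)//; apply/seteqP; split=> // w /= [].
  by [].
rewrite (_ : [set _ | _] = X (ratr q) @^-1` `]c - k.+1%:R^-1, +oo[).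
  rewrite -[X in measurable X]setTI; apply: mX => //.
  by case/andP: qI => + _; exact: le_trans.
by apply/seteqP; split=> w /=; rewrite in_itv/= andbT; [case|].
Qed.

Lemma measurable_sat_psi : measurable [set w | sat (fun t => X t w) psi 0].
Proof.
have -> : [set w | sat (fun t => X t w) psi 0] =
    [set w | forall t, 0 <= t <= 8 -> X t w < 1] `&`
    (* Compact intervals exhaust [(8, 9)]; the shift by 3 makes each of them nondegenerate. *)
    \bigcup_k ~` [set w | forall t, 8 + k.+3%:R^-1 <= t <= 9 - k.+3%:R^-1 ->
                           X t w < 1].
  apply/seteqP; split=> w /=.
    move=> /(sat_psiE (@X_cont w))[h [t /andP[t8 t9] xt]]; split=> //.
    have e0 : 0 < Num.min (t - 8) (9 - t) by rewrite lt_min !subr_gt0 t8.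
    pose k := Num.truncn (Num.min (t - 8) (9 - t))^-1; exists k => // h9.
    have : k.+3%:R^-1 < Num.min (t - 8) (9 - t).
      rewrite invf_plt ?posrE//; apply: lt_trans (truncnS_gt _) _.
      by rewrite ltr_nat.
    move: h9; set e := _^-1 => h9; rewrite lt_min => /andP[k8 k9].
    by move: xt; rewrite leNgt h9//; apply/andP; split; lra.
  move=> [h [k _ h9]]; apply/(sat_psiE (@X_cont w)); split=> //.
  apply: contrapT => K; apply: h9 => t; have : 0 < k.+3%:R^-1 :> R by rewrite invr_gt0.
  set e := _^-1 => e0 /andP[t8 t9]; rewrite ltNge.
  by apply/negP => xt; apply: K; exists t => //; apply/andP; split; lra.
apply: measurableI; first exact: measurable_path_lt.
apply: bigcupT_measurable => k; apply: measurableC.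
have k3 : k.+3%:R^-1 <= 3^-1 :> R by rewrite lef_pV2 ?posrE// ler_nat.
have k0 : 0 < k.+3%:R^-1 :> R by rewrite invr_gt0.
by move: k3 k0; set e := k.+3%:R^-1 => k3 k0; apply: measurable_path_lt; lra.
Qed.

End measurability.

(** * Gaussian estimates *)

Section gaussian_estimates.
Context {R : realType}.
Local Notation mu := lebesgue_measure.

(* Outside [-c, c] half of the Gaussian exponent is at least c^2 / (4 s^2); the
   other half is the density of variance 2 s^2. *)
Lemma normal_pdf_tail_le (s c x : R) : 0 < s -> 0 < c -> c < `|x| ->
  normal_pdf 0 s x <=
    Num.sqrt 2 * expR (- (c ^+ 2 / (4 * s ^+ 2))) * normal_pdf 0 (Num.sqrt 2 * s) x.
Proof.
move=> s0 c0 cx; have r0 : 0 < Num.sqrt 2 :> R by rewrite sqrtr_gt0.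
rewrite !normal_pdfE ?gt_eqF ?mulr_gt0//.
have -> : normal_peak s = Num.sqrt 2 * normal_peak (Num.sqrt 2 * s).
  rewrite /normal_peak exprMn sqr_sqrtr//.
  have -> : 2 * s ^+ 2 * pi *+ 2 = 2 * (s ^+ 2 * pi *+ 2) by ring.
  rewrite sqrtrM// invfM mulrA divff ?mul1r//.
rewrite [leRHS]mulrACA ler_wpM2l ?mulr_ge0 ?normal_peak_ge0 ?sqrtr_ge0//.
rewrite /normal_fun -expRD ler_expR !subr0 exprMn sqr_sqrtr//.
have c2 : c ^+ 2 <= x ^+ 2.
  by rewrite -[x ^+ 2]real_normK ?num_real// ler_sqr ?nnegrE ?ltW// (lt_trans c0).
have s2 : 0 < s ^+ 2 by rewrite exprn_gt0.
rewrite -subr_ge0.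
have -> : - (c ^+ 2 / (4 * s ^+ 2)) + - x ^+ 2 / (2 * s ^+ 2 *+ 2) -
    - x ^+ 2 / (s ^+ 2 *+ 2) = (x ^+ 2 - c ^+ 2) / (4 * s ^+ 2).
  by field; rewrite gt_eqF.
by rewrite divr_ge0 ?subr_ge0// ltW// mulr_gt0.
Qed.

(** Integrating the pointwise bound leaves [sqrt 2 * exp(-y)] with [y = c^2 / (4 s^2)]; then
    [sqrt 2 <= 2] and [exp y >= y^2 / 2] give the constant 64. The fourth power makes the tails
    summable against the [2^m] intervals of level [m]. *)
Lemma normal_prob_tail_le (s c : R) : 0 < s -> 0 < c ->
  (normal_prob 0%R s [set x | (c < `|x|)%R] <= (64 * (s / c) ^+ 4)%:E)%E.
Proof.
move=> s0 c0; set C := [set x | _].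
have mC : measurable C.
  rewrite (_ : C = Num.norm @^-1` `]c, +oo[); last first.
    by apply/seteqP; split=> x /=; rewrite in_itv/= andbT.
  by rewrite -[X in measurable X]setTI; apply: normr_measurable.
set k := Num.sqrt 2 * expR (- (c ^+ 2 / (4 * s ^+ 2))).
have k0 : 0 <= k by rewrite mulr_ge0 ?sqrtr_ge0 ?expR_ge0.
have mpdf t : measurable_fun C (normal_pdf 0 t : R -> R).
  by apply: measurable_funTS; exact: measurable_normal_pdf.
have pdf0 t x : (0 <= (normal_pdf 0 t x : R)%:E)%E by rewrite lee_fin normal_pdf_ge0.
apply: (@le_trans _ _
  (\int[mu]_(x in C) (k%:E * (normal_pdf 0 (Num.sqrt 2 * s) x)%:E))%E).
  apply: ge0_le_integral => //.
  - by apply/measurable_EFinP; exact: mpdf.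
  - by apply: emeasurable_funM => //; apply/measurable_EFinP; exact: mpdf.
  by move=> x cx; rewrite -EFinM lee_fin normal_pdf_tail_le.
rewrite ge0_integralZl//; last by apply/measurable_EFinP; exact: mpdf.
apply: (@le_trans _ _ (k%:E * 1)%E).
  rewrite lee_wpmul2l ?lee_fin//.
  rewrite -(integral_normal_pdf 0 (Num.sqrt 2 * s)).
  by apply: ge0_subset_integral => //; apply/measurable_EFinP; exact: measurable_normal_pdf.
rewrite mule1 lee_fin /k.
set y := c ^+ 2 / (4 * s ^+ 2).
have y0 : 0 < y by rewrite divr_gt0 ?mulr_gt0 ?exprn_gt0.
have -> : 64 * (s / c) ^+ 4 = 2 * (y ^+ 2 / 2)^-1.
  by rewrite /y; field; rewrite !gt_eqF.
apply: ler_pM; rewrite ?sqrtr_ge0 ?expR_ge0//.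
  by rewrite -ler_sqr ?nnegrE ?sqrtr_ge0// sqr_sqrtr//; lra.
rewrite expRN lef_pV2 ?posrE ?expR_gt0 ?divr_gt0 ?exprn_gt0//.
have := expR_ge1Dxn 1 (ltW y0); rewrite (_ : 2`!%:R = 2)//; lra.
Qed.

Lemma normal_prob_itv_ge (s a b m : R) : a < b ->
  (forall x, a <= x <= b -> m <= normal_pdf 0 s x) -> 0 <= m ->
  (((b - a) * m)%:E <= normal_prob 0%R s `[a, b])%E.
Proof.
move=> ab h m0; apply: (@le_trans _ _ (\int[mu]_(x in `[a, b]) m%:E)%E).
  by rewrite integral_cst//= lebesgue_measure_itv/= lte_fin ab -EFinD -EFinM mulrC.
apply: ge0_le_integral => //.
apply/measurable_EFinP; apply: measurable_funTS.
exact: measurable_normal_pdf.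
Qed.

Lemma normal_prob_itv_gt0 (s a b : R) : 0 < s -> 0 <= a < b ->
  (0 < normal_prob 0%R s `[a, b])%E.
Proof.
move=> s0 /andP[a0 ab]; pose m := normal_pdf 0 s b.
have m0 : 0 < m.
  by rewrite /m normal_pdfE ?gt_eqF// mulr_gt0 ?expR_gt0// normal_peak_gt0 ?gt_eqF.
apply: lt_le_trans (normal_prob_itv_ge ab _ (ltW m0)).
  by rewrite lte_fin mulr_gt0// subr_gt0.
move=> x /andP[ax xb]; rewrite /m !normal_pdfE ?gt_eqF//.
rewrite ler_wpM2l ?normal_peak_ge0// ler_expR !subr0 ler_pM2r; last first.
  by rewrite invr_gt0 pmulrn_rgt0// exprn_gt0.
by rewrite lerN2 ler_sqr ?nnegrE//; lra.
Qed.

(** By scaling, length times minimal density on [[-s, 0]] does not depend on [s]. The uniform bound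
    keeps the block probability away from 0 as the blocks shrink. *)
Lemma normal_prob_small_negative_ge : exists2 q : R, 0 < q &
  forall s : R, 0 < s <= 1 -> (q%:E <= normal_prob 0%R s `[(-1)%R, 0%R])%E.
Proof.
pose q : R := normal_peak 1 * expR (- 2^-1); exists q.
  by rewrite mulr_gt0 ?expR_gt0// normal_peak_gt0 ?oner_neq0.
move=> s /andP[s0 s1]; pose m := normal_peak s * expR (- 2^-1).
have sub : (`[(- s), 0] : set R) `<=` `[-1, 0].
  by move=> x /=; rewrite !in_itv/= => /andP[? ?]; apply/andP; split; lra.
apply: (@le_trans _ _ (normal_prob 0%R s `[(- s), 0])); last first.
  by apply: le_measure => //; rewrite inE; exact: measurable_itv.
have -> : q = (0 - - s) * m.
  have -> : m = s^-1 * q.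
    rewrite /m /q mulrA /normal_peak expr1n mul1r -mulrnAr sqrtrM ?sqr_ge0//.
    by rewrite sqrtr_sqr gtr0_norm// invfM.
  by rewrite opprK add0r mulrA divff ?mul1r// gt_eqF.
apply: normal_prob_itv_ge; first lra; last first.
  by rewrite mulr_ge0 ?normal_peak_ge0 ?expR_ge0.
move=> x /andP[sx x0]; rewrite /m normal_pdfE ?gt_eqF//.
rewrite ler_wpM2l ?normal_peak_ge0// ler_expR subr0.
have s2 : 0 < s ^+ 2 by rewrite exprn_gt0.
rewrite mulNr lerN2 ler_pdivrMr ?pmulrn_rgt0//.
have : x ^+ 2 <= s ^+ 2 by nra.
lra.
Qed.

End gaussian_estimates.

(** * Chaining and increments *)

Section chaining.
Context {R : realType}.
Variables (x : R -> R) (a h : R) (c : nat -> R).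
Hypothesis h_gt0 : 0 < h.
Hypothesis step : forall m k, (k < 2 ^ m)%N ->
  `|x (a + k.+1%:R * (h / 2 ^+ m)) - x (a + k%:R * (h / 2 ^+ m))| <= c m.

(** An even index already belongs to the coarser level; an odd one is a single fine step away from
    its even predecessor. *)
Lemma dyadic_chaining m k : (k <= 2 ^ m)%N ->
  `|x (a + k%:R * (h / 2 ^+ m)) - x a| <= \sum_(i < m.+1) c i.
Proof.
elim: m k => [|m IH] k.
  rewrite expn0 big_ord1 => k1.
  have := @step 0%N 0%N isT; rewrite mul0r addr0.
  case: k k1 => [|[|//]] _; last by [].
  by rewrite mul0r addr0 subrr normr0; apply: le_trans.
rewrite big_ord_recr/= => km.
have half i : (i.*2)%:R * (h / 2 ^+ m.+1) = i%:R * (h / 2 ^+ m).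
  rewrite exprS -muln2 natrM; field.
  by rewrite expf_neq0.
have c0 : 0 <= c m.+1.
  by apply: le_trans (@step m.+1 0%N _); rewrite ?normr_ge0 ?expn_gt0.
have kE := odd_double_half k.
have k2m : (k./2 <= 2 ^ m)%N by move: km; rewrite expnS; lia.
case: (odd k) kE => /= kE; last first.
  by rewrite -kE add0n half ler_wpDr// IH.
rewrite -kE add1n.
apply: le_trans (ler_distD (x (a + (k./2.*2)%:R * (h / 2 ^+ m.+1))) _ _) _.
rewrite [leRHS]addrC lerD//; last by rewrite half IH.
by apply: step; lia.
Qed.

Hypothesis x_cont : {within `[0, +oo[, continuous x}.

Lemma dyadic_chaining_le (C : R) : 0 <= a ->
  (forall m, \sum_(i < m.+1) c i <= C) ->
  forall t, a <= t <= a + h -> x t <= x a + C.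
Proof.
move=> a0 cC t /andP[at_ th]; apply: (path_closed_le x_cont); first lra.
(* Since [2^m > m > h / e], the mesh of level [m] is below [e]. *)
move=> e e0; pose m := (Num.truncn (h / e)).+1.
pose dl := h / 2 ^+ m.
have dl0 : 0 < dl by rewrite divr_gt0// exprn_gt0.
have dle : dl < e.
  rewrite /dl ltr_pdivrMr ?exprn_gt0// mulrC -ltr_pdivrMr//.
  apply: lt_trans (truncnS_gt _) _; rewrite -natrX ltr_nat.
  exact: ltn_expl.
pose k := Num.truncn ((t - a) / dl).
have ta : 0 <= (t - a) / dl by rewrite divr_ge0 ?subr_ge0// ltW.
have /andP[k1 k2] := truncn_itv ta; rewrite -/k in k1 k2.
rewrite ler_pdivlMr// in k1; rewrite ltr_pdivrMr// in k2.
have km : (k <= 2 ^ m)%N.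
  rewrite -(ler_nat R) natrX -(ler_pM2r dl0); apply: (le_trans k1).
  by rewrite /dl mulrCA divff ?mulr1; [lra|rewrite expf_neq0].
have kdl : 0 <= k%:R * dl by rewrite mulr_ge0 // ltW.
exists (a + k%:R * dl).
  rewrite distrC ger0_norm; last lra.
  by move: k2; rewrite -natr1 mulrDl mul1r; lra.
split; first lra.
by have := dyadic_chaining km; rewrite -/dl ler_norml => /andP[_]; have := cC m; lra.
Qed.

End chaining.

(** * Events prescribed by successive increments *)

Section increment_events.
Context {d : measure_display} {T : measurableType d} {R : realType}.
Variables (X : R -> T -> R).
Implicit Types (t : R) (l : seq (R * set R)).

Definition duration l : R := \sum_(b <- l) b.1.

Fixpoint inc_event t l : set T :=
  if l is b :: l' then
    [set w | b.2 (X (t + b.1) w - X t w)] `&` inc_event (t + b.1) l'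
  else setT.

Lemma inc_event_cat t l1 l2 :
  inc_event t (l1 ++ l2) = inc_event t l1 `&` inc_event (t + duration l1) l2.
Proof.
rewrite /duration; elim: l1 t => [|b l1 IH] t /=.
  by rewrite big_nil addr0 setTI.
by rewrite IH big_cons addrA setIA.
Qed.

(** One block is cut into three, and its constraint is traded for one on the middle piece; the other
    blocks keep theirs. *)
Lemma inc_event_refine t l1 l2 (h s1 s2 s3 : R) (B C : set R) w :
  s1 + s2 + s3 = h -> inc_event t (l1 ++ (h, B) :: l2) w ->
  C (X (t + duration l1 + s1 + s2) w - X (t + duration l1 + s1) w) ->
  inc_event t (l1 ++ [:: (s1, setT), (s2, C), (s3, setT) & l2]) w.
Proof.
move=> sh; rewrite !inc_event_cat => -[w1 [_ w2]] wC; split=> //=.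
split=> //; split=> //; split=> //.
by move: w2 => /=; rewrite -sh !addrA.
Qed.

Lemma inc_event_nseq t n h B w : inc_event t (nseq n (h, B)) w ->
  forall i, (i < n)%N -> B (X (t + i.+1%:R * h) w - X (t + i%:R * h) w).
Proof.
elim: n t => // n IH t /= [w1 w2] [|i].
  by rewrite mul0r addr0 mul1r.
have E k : t + h + k%:R * h = t + k.+1%:R * h by rewrite -nat1r; ring.
by rewrite ltnS => /(IH _ w2); rewrite /= !E.
Qed.

(** Zero durations are allowed without constraint, because the pieces beside the first or last
    dyadic interval of a block may be empty. *)
Definition admissible (b : R * set R) : Prop :=
  [/\ 0 <= b.1, b.1 = 0 -> b.2 = setT & measurable b.2].

Local Notation all_admissible := (all (fun b => `[< admissible b >])).

(* Degenerate increments can be dropped, which lets the independence of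
   increments over strictly increasing times apply. *)
Lemma inc_event_filter t l : all_admissible l ->
  inc_event t l = inc_event t [seq b <- l | b.1 != 0].
Proof.
elim: l t => //= b l IH t /andP[/asboolP[b0 bT _] al].
have [e|_] /= := eqVneq b.1 0; last by rewrite IH.
by rewrite e addr0 bT// IH// (_ : [set _ | _] = setT) ?setTI//; apply/seteqP.
Qed.

Hypothesis mX : forall t, 0 <= t -> measurable_fun setT (X t).

Lemma measurable_inc_event t l : 0 <= t -> all_admissible l ->
  measurable (inc_event t l).
Proof.
elim: l t => //= b l IH t t0 /andP[/asboolP[b0 _ mb] al].
apply: measurableI; last by apply: IH => //; exact: addr_ge0.
rewrite -[X in measurable X]setTI.
have : measurable_fun setT (X (t + b.1) \- X t).
  by apply: measurable_funB; apply: mX => //; exact: addr_ge0.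
exact.
Qed.

End increment_events.

(** * Product formula for increment events *)

Section increment_probability.
Context {d : measure_display} {T : measurableType d} {R : realType}.
Variables (P : probability T R) (X : R -> T -> R).
Hypothesis X_BM : standard_BM P X.
Implicit Types (t : R) (l : seq (R * set R)).

Local Notation all_admissible := (all (fun b => `[< admissible b >])).
Local Notation times t l := (t :: scanl (fun u b => u + b.1) t l).
Local Notation b0 := (0 : R, setT : set R).

Definition gauss (b : R * set R) : R := fine (normal_prob 0 (Num.sqrt b.1) b.2).

Lemma gaussE b : measurable b.2 ->
  (gauss b)%:E = normal_prob 0 (Num.sqrt b.1) b.2.
Proof. by move=> mb; rewrite fineK// fin_num_measure. Qed.

Lemma gauss_ge0 b : 0 <= gauss b.
Proof. by rewrite fine_ge0// measure_ge0. Qed.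

Lemma gauss_setT h : gauss (h, setT) = 1.
Proof. by rewrite /gauss/= probability_setT. Qed.

Lemma prod_gauss_filter l : all_admissible l ->
  \prod_(b <- l) gauss b = \prod_(b <- [seq b <- l | b.1 != 0]) gauss b.
Proof.
elim: l => //= b l IH /andP[/asboolP[_ bT _] al]; rewrite big_cons IH//.
have [e|_] := eqVneq b.1 0; last by rewrite big_cons.
by rewrite (surjective_pairing b) bT// gauss_setT mul1r.
Qed.

Lemma inc_eventE t l w : inc_event X t l w <->
  forall i, (i < size l)%N -> (nth b0 l i).2 (increment X (times t l) i w).
Proof.
elim: l t => [|b l IH] t; first by split.
split=> [[w1 /IH w2] [//|i]|h]; first exact: w2.
by split; [exact: (h 0%N)|apply/IH => i; exact: (h i.+1)].
Qed.

Lemma nth_times t l i : (i < size l)%N ->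
  nth 0 (times t l) i.+1 = nth 0 (times t l) i + (nth b0 l i).1.
Proof. by elim: l t i => // b l IH t [|i] //= /(IH (t + b.1)). Qed.

Lemma nth_times_ge0 t l i : 0 <= t -> all_admissible l ->
  0 <= nth 0 (times t l) i.
Proof.
elim: l t i => [|b l IH] t [|i] //= t0; first by rewrite nth_nil.
by move=> /andP[/asboolP[b0 _ _] al]; apply: IH => //; exact: addr_ge0.
Qed.

Lemma sorted_times t l : all_admissible l -> all (fun b => b.1 != 0) l ->
  sorted <%R (times t l).
Proof.
elim: l t => //= b l IH t /andP[/asboolP[b0 _ _] al] /andP[bn al'].
by rewrite IH// andbT ltrDl lt_neqAle eq_sym bn.
Qed.

Lemma prob_inc_event t l : 0 <= t -> all_admissible l ->
  P (inc_event X t l) = (\prod_(b <- l) gauss b)%:E.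
Proof.
have [mX _ _ X_gauss X_indep] := X_BM.
move=> t0 al; rewrite inc_event_filter//.
rewrite prod_gauss_filter//; set l' := [seq b <- l | b.1 != 0].
have al' : all_admissible l' by rewrite all_filter; apply: sub_all al => b /= ->; rewrite implybT.
have nl' : all (fun b => b.1 != 0) l' by exact: filter_all.
have sz : (size (times t l')).-1 = size l' by rewrite /= size_scanl.
have -> : inc_event X t l' = \bigcap_(i in `I_(size (times t l')).-1)
    (increment X (times t l') i @^-1` (nth b0 l' i).2).
  rewrite sz; apply/seteqP; split=> w.
    by move=> /inc_eventE h i /= il; exact: h.
  by move=> h; apply/inc_eventE => i il; exact: (h i).
rewrite X_indep//.
- rewrite sz (big_nth b0) big_mkord -prodEFin; apply: eq_bigr => i _.
  have ad : admissible (nth b0 l' i) by move/all_nthP: al' => /(_ b0 i (ltn_ord i))/asboolP.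
  have ne : (nth b0 l' i).1 != 0 by move/all_nthP: nl' => /(_ b0 i (ltn_ord i)).
  case: ad => ad1 _ ad2; rewrite gaussE//.
  have ti := nth_times t (ltn_ord i).
  have t_ge0 := nth_times_ge0 i t0 al'.
  have t_lt : nth 0 (times t l') i < nth 0 (times t l') i.+1.
    by rewrite ti ltrDl lt_neqAle eq_sym ne.
  have -> : (nth b0 l' i).1 = nth 0 (times t l') i.+1 - nth 0 (times t l') i.
    by rewrite ti addrAC subrr add0r.
  exact: (X_gauss _ _ t_ge0 t_lt _ ad2).
- exact: sorted_times.
- move=> i; have [il|il] := ltnP i (size l').
    by move/all_nthP: al' => /(_ b0 i il)/asboolP[].
  by rewrite nth_default//; exact: measurableT.
Qed.

End increment_probability.

(** The left side is the union bound over all levels, 7 bounding the geometric series. The [N]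
    blocks contribute [N (8/N)^2 = 64/N], which for large [N] beats the missing factor [q]. *)
Lemma chaining_budget {R : realType} (A q r : R) (N : nat) : (0 < N)%N ->
  0 < q -> 0 < r -> A * (7 * 8 ^+ 2) / N%:R < q ->
  q ^+ N.-1 * r * (N%:R * (A * (8 / N%:R) ^+ 2)) * 7 < q ^+ N * r.
Proof.
move=> N0 q0 r0 AN; have NR : 0 < N%:R :> R by rewrite ltr0n.
have -> : q ^+ N * r = q ^+ N.-1 * r * q.
  have -> : q ^+ N = q ^+ N.-1 * q by rewrite -exprSr prednK.
  exact: mulrAC.
have qr0 : 0 < q ^+ N.-1 * r by rewrite mulr_gt0// exprn_gt0.
rewrite -mulrA (ltr_pM2l qr0).
have -> : N%:R * (A * (8 / N%:R) ^+ 2) * 7 = A * (7 * 8 ^+ 2) / N%:R.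
  by field; rewrite gt_eqF.
exact: AN.
Qed.

(** * Good paths outweigh bad increments *)

Section positivity.
Context {d : measure_display} {T : measurableType d} {R : realType}.
Variables (P : probability T R) (X : R -> T -> R).
Hypothesis X_BM : standard_BM P X.

Let mX : forall t, 0 <= t -> measurable_fun setT (X t). Proof. by case: X_BM. Qed.
Let X0 : forall w, X 0 w = 0. Proof. by case: X_BM. Qed.
Let X_cont : forall w, {within `[0, +oo[, continuous (fun t => X t w)}.
Proof. by case: X_BM. Qed.

(* The numerical constant is kept abstract: unfolding it makes conversion
   compute with unary numerals. *)
Variable A : R.
Hypothesis A_def : A = 64 * 16 ^+ 4.
Variable N : nat.
Hypothesis N_gt0 : (0 < N)%N.
Let h : R := 8 / N%:R.
Let B : set R := `[-1, 0].
(** After [N] blocks the path is at least [-N], so such an increment lifts it to at least 1. *)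
Let D : set R := `[N%:R + 1, N%:R + 2].
(** The series sums to [1/2], while [(7/8)^4 > 1/2] makes the decay slow enough for the tail bounds
    to be summable. *)
Let c m : R := 16^-1 * (7 / 8) ^+ m.
Let C m : set R := [set y | c m < `|y|].
Let dl m : R := h / 2 ^+ m.
Let tail : seq (R * set R) := [:: (2^-1, D)].
Let good : seq (R * set R) := nseq N (h, B) ++ tail.
(** The [k]-th dyadic increment of level [m] in block [j] is too large. Block [j] loses its
    constraint [B], so that the pieces remain independent. *)
Let bad (j m k : nat) : seq (R * set R) :=
  nseq j (h, B) ++ [:: (k%:R * dl m, setT), (dl m, C m),
    ((2 ^ m - k.+1)%:R * dl m, setT) & nseq (N - j.+1) (h, B) ++ tail].

Let N_gt0R : 0 < N%:R :> R. Proof. by rewrite ltr0n. Qed.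
Let h_gt0 : 0 < h. Proof. by rewrite divr_gt0. Qed.
Let NhE : N%:R * h = 8. Proof. by rewrite /h mulrCA divff ?mulr1// gt_eqF. Qed.
Let dl_gt0 m : 0 < dl m. Proof. by rewrite divr_gt0// exprn_gt0. Qed.
Let c_gt0 m : 0 < c m. Proof. by rewrite mulr_gt0 ?invr_gt0// exprn_gt0// divr_gt0. Qed.

Let c_sum m : \sum_(i < m.+1) c i <= 2^-1.
Proof.
have -> : \sum_(i < m.+1) c i = 2^-1 - 2^-1 * (7 / 8) ^+ m.+1.
  elim: m => [|m IH]; first by rewrite big_ord1 /c expr0 expr1; field.
  by rewrite big_ord_recr/= IH /c !exprS; field.
by rewrite lerBlDr lerDl mulr_ge0 ?invr_ge0// exprn_ge0// divr_ge0.
Qed.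

Let duration_nseq j : duration (nseq j (h, B)) = j%:R * h.
Proof. by rewrite /duration big_nseq/= iter_addr_0 mulr_natl. Qed.

(** Each block starts at a value at most 0 and rises by at most [1/2], so there is no hit up to time
    8; the last increment forces one at [17/2]. *)
Lemma good_path_sat_psi w : inc_event X 0 good w ->
  (forall j m k, (j < N)%N -> (k < 2 ^ m)%N -> ~ inc_event X 0 (bad j m k) w) ->
  sat (fun t => X t w) psi 0.
Proof.
move=> wG wB.
have [wN [wD _]] : inc_event X 0 (nseq N (h, B)) w /\
    inc_event X (N%:R * h) tail w.
  by move: wG; rewrite /good inc_event_cat duration_nseq add0r.
have inc i : (i < N)%N -> X (i%:R * h) w - 1 <= X (i.+1%:R * h) w <= X (i%:R * h) w.
  move=> iN; have := inc_event_nseq wN iN.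
  by rewrite !add0r /B/= in_itv/= => /andP[? ?]; apply/andP; split; lra.
have pos i : (i <= N)%N -> - i%:R <= X (i%:R * h) w <= 0.
  elim: i => [|i IH] iN; first by rewrite mul0r X0 oppr0 lexx.
  have := inc _ iN; set z := X (i.+1%:R * h) w.
  have /andP[? ?] := IH (ltnW iN) => /andP[? ?]; rewrite -natr1.
  by apply/andP; split; lra.
have step j m k : (j < N)%N -> (k < 2 ^ m)%N ->
    `|X (j%:R * h + k.+1%:R * dl m) w - X (j%:R * h + k%:R * dl m) w| <= c m.
  move=> jN km; rewrite leNgt; apply/negP => cX; apply: (wB j m k jN km).
  apply: (@inc_event_refine _ _ _ _ _ _ _ h _ _ _ B).
  - rewrite natrB// natrX /dl -natr1; field.
    by rewrite expf_neq0.
  - move: wG; rewrite /good [in X in X -> _](_ : N = j + (1 + (N - j.+1)))%N; last lia.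
    by rewrite nseqD -catA.
  - rewrite duration_nseq add0r /C/=.
    by move: cX; rewrite -natr1 mulrDl mul1r addrA.
apply/(sat_psiE (@X_cont w)); split; last first.
  exists (8 + 2^-1); first by apply/andP; split; lra.
  move: wD; rewrite /= NhE /D/= in_itv/= => /andP[+ _].
  by have /andP[+ _] := pos N (leqnn N); rewrite NhE; lra.
move=> t /andP[t0 t8].
pose j := Num.truncn (t / h).
have /andP[j1 j2] := @truncn_itv _ (t / h) (divr_ge0 t0 (ltW h_gt0)).
rewrite -/j ler_pdivlMr// in j1; rewrite -/j ltr_pdivrMr// in j2.
(* The index [N] arises only for [t = 8], the end of the last block. *)
have [jN|Nj] := ltnP j N; last first.
  have : N%:R * h <= j%:R * h by rewrite ler_pM2r// ler_nat.
  rewrite NhE => h8; have -> : t = N%:R * h by rewrite NhE; lra.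
  by have /andP[_] := pos N (leqnn N); lra.
have /andP[_ xj] := pos j (ltnW jN).
have jh : 0 <= j%:R * h by rewrite mulr_ge0 // ltW.
have : X t w <= X (j%:R * h) w + 2^-1.
  apply: (@dyadic_chaining_le _ (fun t => X t w) (j%:R * h) h c) => //.
  - by move=> m k km; exact: step.
  - apply/andP; split; first by [].
    by move: j2; rewrite -natr1 mulrDl mul1r; lra.
lra.
Qed.

Let q : R := gauss (h, B).
Let r : R := gauss (2^-1, D).

Let admissible_hB : admissible (h, B).
Proof.
split=> /=; [exact: ltW|by move=> e; move: h_gt0; rewrite e ltxx|].
exact: measurable_itv.
Qed.

Let admissible_tail : admissible (2^-1 : R, D).
Proof.
split=> /=; [by rewrite invr_ge0|by move/eqP; rewrite invr_eq0 pnatr_eq0|].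
exact: measurable_itv.
Qed.

Let measurable_C m : measurable (C m).
Proof.
rewrite (_ : C m = Num.norm @^-1` `]c m, +oo[); last first.
  by apply/seteqP; split=> y /=; rewrite in_itv/= andbT.
by rewrite -[X in measurable X]setTI; apply: normr_measurable.
Qed.

Let admissible_setT (s : R) : 0 <= s -> admissible (s, setT).
Proof. by move=> s0; split=> //=; exact: measurableT. Qed.

Let admissible_C m : admissible (dl m, C m).
Proof.
split=> /=; [exact: ltW|by move=> e; move: (dl_gt0 m); rewrite e ltxx|].
exact: measurable_C.
Qed.

Let admissible_good : all (fun b => `[< admissible b >]) good.
Proof.
rewrite all_cat all_nseq/= andbT; apply/andP; split; last exact/asboolP.
by apply/orP; right; exact/asboolP.
Qed.

Let admissible_bad j m k : all (fun b => `[< admissible b >]) (bad j m k).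
Proof.
have hB n : all (fun b => `[< admissible b >]) (nseq n (h, B)).
  by rewrite all_nseq; apply/orP; right; exact/asboolP.
rewrite all_cat hB/= all_cat hB/= andbT.
have dT n : `[< admissible (n%:R * dl m, setT : set R) >].
  by apply/asboolP; apply: admissible_setT; rewrite mulr_ge0// ltW.
rewrite !dT/= (asboolT (admissible_C m))/=; exact/asboolP/admissible_tail.
Qed.

Let prob_good : P (inc_event X 0 good) = (q ^+ N * r)%:E.
Proof.
rewrite (prob_inc_event X_BM (lexx 0) admissible_good) big_cat/= big_nseq iter_mulr_1.
by rewrite big_cons big_nil mulr1.
Qed.

Let prob_bad j m k : (j < N)%N ->
  P (inc_event X 0 (bad j m k)) = (q ^+ N.-1 * r * gauss (dl m, C m))%:E.
Proof.
move=> jN; rewrite (prob_inc_event X_BM (lexx 0) (admissible_bad j m k)) big_cat !big_cons.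
rewrite (gauss_setT (k%:R * dl m)) (gauss_setT ((2 ^ m - k.+1)%:R * dl m)).
rewrite big_cat !big_nseq !iter_mulr_1 big_cons big_nil -/q -/r.
have -> : N.-1 = (j + (N - j.+1))%N by lia.
by rewrite exprD /=; congr EFin; move: (gauss _) => g; ring.
Qed.

(** The ratio between levels: the number of intervals doubles, the squared variance drops by 4, and
    [c m ^+ 4] by [(7/8)^4]. *)
Let rho : R := (8 / 7) ^+ 4 / 2.

Let gauss_C m : 2 ^+ m * gauss (dl m, C m) <= A * h ^+ 2 * rho ^+ m.
Proof.
have : gauss (dl m, C m) <= 64 * (dl m ^+ 2 / c m ^+ 4).
  rewrite -lee_fin gaussE; last exact: measurable_C.
  have -> : dl m ^+ 2 / c m ^+ 4 = (Num.sqrt (dl m) / c m) ^+ 4.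
    rewrite [RHS]expr_div_n; congr (_ / _).
    by rewrite (exprM _ 2 2) sqr_sqrtr// ltW.
  by apply: normal_prob_tail_le; rewrite ?sqrtr_gt0; [exact: dl_gt0|exact: c_gt0].
rewrite -(@ler_pM2l _ (2 ^+ m)) ?exprn_gt0// => /le_trans; apply.
rewrite le_eqVlt; apply/orP; left; apply/eqP.
rewrite A_def; have -> : rho ^+ m = (8 ^+ m / 7 ^+ m) ^+ 4 / 2 ^+ m.
  by rewrite /rho exprMn exprVn exprAC expr_div_n.
by rewrite /c /dl [(7 / 8) ^+ m]expr_div_n; field; rewrite !expf_neq0.
Qed.

Let rho_sum M : \sum_(i < M) rho ^+ i <= 7.
Proof.
(* Here [2401 / 353 = 1 / (1 - rho)], just below 7. *)
have -> : \sum_(i < M) rho ^+ i = 2401 / 353 * (1 - rho ^+ M).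
  elim: M => [|M IH]; first by rewrite big_ord0 expr0 subrr mulr0.
  by rewrite big_ord_recr/= IH exprS /rho; field.
have : 0 <= rho ^+ M by rewrite exprn_ge0// divr_ge0.
lra.
Qed.

Let F m j := \big[setU/set0]_(k < 2 ^ m) inc_event X 0 (bad j m k).
Let Bad m := \big[setU/set0]_(j < N) F m j.

Let measurable_bad j m k : measurable (inc_event X 0 (bad j m k)).
Proof. exact: measurable_inc_event. Qed.

Let measurable_Bad m : measurable (Bad m).
Proof. by do 2!apply: bigsetU_measurable => ? _; exact: measurable_bad. Qed.

Let K : R := q ^+ N.-1 * r * (N%:R * (A * h ^+ 2)).

Let A_gt0 : 0 < A. Proof. by rewrite A_def mulr_gt0// exprn_gt0. Qed.

Let K_ge0 : 0 <= K.
Proof. by rewrite /K !mulr_ge0 ?exprn_ge0 ?gauss_ge0// ltW. Qed.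

Let prob_Bad m : (P (Bad m) <= (K * rho ^+ m)%:E)%E.
Proof.
pose p := q ^+ N.-1 * r * gauss (dl m, C m).
apply: (@le_trans _ _ (\sum_(j < N) \sum_(k < 2 ^ m) p%:E)%E).
  have mF j : measurable (F m j) by apply: bigsetU_measurable.
  apply: (@le_trans _ _ (\sum_(j < N) P (F m j))%E).
    by apply: content_subadditive.
  apply: lee_sum => j _.
  apply: (@le_trans _ _ (\sum_(k < 2 ^ m) P (inc_event X 0 (bad j m k)))%E).
    by apply: (@content_subadditive _ _ _ _ _ (fun k => inc_event X 0 (bad j m k))).
  by apply: lee_sum => k _; rewrite prob_bad.
under eq_bigr do rewrite sumEFin; rewrite sumEFin lee_fin !sumr_const !card_ord.
rewrite -mulrnA -[leLHS]mulr_natl natrM natrX /p /K.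
rewrite [leLHS](_ : _ = q ^+ N.-1 * r * (N%:R * (2 ^+ m * gauss (dl m, C m)))); last by ring.
rewrite -!mulrA ler_wpM2l ?exprn_ge0 ?gauss_ge0//.
rewrite ler_wpM2l ?gauss_ge0// ler_wpM2l// !mulrA.
by have := gauss_C m; rewrite !mulrA.
Qed.

(** The bad events of all levels together have probability at most [7 K], which is less than that of
    the good event, so their difference has positive probability. *)
Lemma prob_sat_psi_gt0 : 0 < r -> A * (7 * 8 ^+ 2) / N%:R < q ->
  (0 < P [set w | sat (fun t => X t w) psi 0])%E.
Proof.
move=> r0 qN; have q0 : 0 < q.
  apply: le_lt_trans qN; apply: divr_ge0; last exact: ltW.
  by apply: mulr_ge0; [exact: ltW|apply: mulr_ge0; [|exact: exprn_ge0]].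
pose BadU := \bigcup_m Bad m.
have mBadU : measurable BadU by exact: bigcupT_measurable.
have mgood : measurable (inc_event X 0 good) by exact: measurable_inc_event.
have PBad : (P BadU <= (K * 7)%:E)%E.
  apply: le_trans (measure_sigma_subadditive P measurable_Bad mBadU _) _ => //.
  apply: lime_le.
    by apply: is_cvg_nneseries => n _ _; exact: measure_ge0.
  apply: nearW => M.
  apply: (@le_trans _ _ (\sum_(0 <= m < M) (K * rho ^+ m)%:E)%E).
    by apply: lee_sum => m _; exact: prob_Bad.
  rewrite sumEFin lee_fin -mulr_sumr big_mkord.
  by apply: ler_wpM2l; [exact: K_ge0|exact: rho_sum].
have Pgood : ((K * 7)%:E < P (inc_event X 0 good))%E.
  by rewrite prob_good lte_fin; exact: chaining_budget.
have Pdiff : (0 < P (inc_event X 0 good `\` BadU))%E.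
  rewrite measureD//; last by rewrite (le_lt_trans (probability_le1 P mgood)) ?ltry.
  rewrite sube_gt0; apply: le_lt_trans Pgood; apply: le_trans PBad.
  apply: le_measure; rewrite ?inE//.
  exact: measurableI.
apply: lt_le_trans Pdiff _; apply: le_measure; rewrite ?inE.
- exact: measurableD.
- exact: measurable_sat_psi.
move=> w [wG wB]; apply: good_path_sat_psi => // j m k jN km wb; apply: wB.
exists m => //; rewrite /Bad -(bigcup_mkord N (F m)); exists j => //.
by rewrite /F -(bigcup_mkord _ (fun k => inc_event X 0 (bad j m k))); exists k.
Qed.

End positivity.

Lemma standard_BM_sat_psi_gt0 {d : measure_display} {T : measurableType d}
    {R : realType} (P : probability T R) (X : R -> T -> R) : standard_BM P X ->
  (0 < P [set w | sat (fun t => X t w) psi 0])%E.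
Proof.
move=> X_BM; have [q0 q0_gt0 hq0] := @normal_prob_small_negative_ge R.
have [A A_def] : exists A : R, A = 64 * 16 ^+ 4 by eexists.
(* The summand 8 gives [8/N <= 1], so that [q0] bounds the block probability from below; the other
   summand makes the chaining error smaller than [q0]. *)
pose N := (8 + Num.truncn (A * (7 * 8 ^+ 2) / q0))%N.
have N_gt0 : (0 < N)%N by [].
have N0 : 0 < N%:R :> R by rewrite ltr0n.
apply: (@prob_sat_psi_gt0 _ _ _ _ _ X_BM A A_def N N_gt0).
  rewrite -lte_fin gaussE; last exact: measurable_itv.
  apply: normal_prob_itv_gt0; first by rewrite sqrtr_gt0 invr_gt0.
  by apply/andP; split; lra.
apply: (@lt_le_trans _ _ q0).
  have : A * (7 * 8 ^+ 2) / q0 < N%:R.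
    by apply: lt_le_trans (truncnS_gt _) _; rewrite ler_nat -add1n leq_add2r.
  by rewrite !ltr_pdivrMr// (mulrC q0).
rewrite -lee_fin gaussE; last exact: measurable_itv.
apply: hq0; rewrite sqrtr_gt0 divr_gt0//=.
rewrite -[leRHS]sqrtr1 ler_wsqrtr// ler_pdivrMr// mul1r.
by rewrite ler_nat leq_addr.
Qed.

Theorem theorem5p6 (d : measure_display) (T : measurableType d) (R : realType)
  (P : probability T R) (X : R -> T -> R) :
  standard_BM P X ->
  ~ (P [set w | satn n (fun t => X t w) psi 0] @[n --> \oo] -->
     P [set w | sat (fun t => X t w) psi 0]).
Proof.
move=> X_BM cvgP; have := standard_BM_sat_psi_gt0 X_BM.
(* The discrete events are empty from [n = 2] on, so a limit equal to the continuous probability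
   would have to be 0. *)
have cvg0 : P [set w | satn n (fun t => X t w) psi 0] @[n --> \oo] --> (0 : \bar R).
  apply: cvg_near_cst; exists 2%N => // n /= n2.
  rewrite (_ : [set _ | _] = set0) ?measure0//.
  by apply/seteqP; split=> // w; exact: (@satn_psi_false _ n (fun t => X t w) n2).
by rewrite -(cvg_unique _ cvg0 cvgP) ?ltxx//; exact: ereal_hausdorff.
Qed.
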